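(* Let $T$ be a nontrivial tree (that is, a tree with at least two vertices). Then $\alpha_{\rm es}(T)=\alpha(T)-1$ if and only if $T$ is a star $K_{1,t}$ with $t\ge 1$, or $T\in \mathcal{A}\cup \mathcal{B} \cup \mathcal{C}$.
   Context: All graphs are finite and simple; $\alpha(G)$ is the independence number. For $B\subseteq V(G)$, $N[B]=\bigcup_{b\in B}N[b]$ and $N(B)=N[B]- B$. A set $B\subseteq V(G)$ is an externally supported independence set (ESI-set) if $B$ is independent and every $v\in N(B)$ has a neighbor in $V(G)- N[B]$ (the empty set is an ESI-set); $\alpha_{\rm es}(G)$ is the maximum cardinality of an ESI-set of $G$. Family $\mathcal{A}$: all trees obtained as follows. Start with a star $K_{1,t}$, $t\ge 2$, with center $x$; for each leaf $v$ of this star, attach $k_v\ge 1$ new leaves to $v$. Family $\mathcal{B}$: all trees obtained as follows. Start with a star $K_{1,t}$, $t\ge 2$, with center $x$; for each leaf $v$ of this star with the exception of precisely one leaf $y$, attach $k_v\ge 1$ new leaves to $v$ (so among the neighbors of $x$ only $y$ remains a leaf). Family $\mathcal{C}$: all trees obtained as follows. Start with a double star $S_{a,b}$, $a,b\ge 1$, i.e. the tree obtained from an edge $xy$ by attaching $a$ leaves to $x$ and $b$ leaves to $y$; for each leaf $v$ of $S_{a,b}$, attach $k_v\ge 1$ new leaves to $v$. *)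

(* Defs.v *)
From mathcomp Require Import all_boot.

Set Implicit Arguments.
Unset Strict Implicit.
Unset Printing Implicit Defensive.

Record sgraph := SGraph {
  vertex :> finType;
  edge : rel vertex;
  edge_sym : symmetric edge;
  edge_irrefl : irreflexive edge }.

Notation "u -- v" := (edge u v) (at level 30).

(* The vertex lists in [ucycle] are duplicate-free; those of size at most 2
   (the empty list, and an edge traversed back and forth) are not graph
   cycles. *)
Definition acyclic (G : sgraph) : Prop :=
  forall c : seq G, ucycle (@edge G) c -> size c <= 2.

Definition connected (G : sgraph) : Prop :=
  0 < #|G| /\ forall u v : G, connect (@edge G) u v.

Definition is_tree (G : sgraph) : Prop := connected G /\ acyclic G.

Definition isomorphic (G H : sgraph) : Prop :=
  exists2 f : G -> H, bijective f & forall u v : G, f u -- f v = u -- v.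

Section Sets.
Variable G : sgraph.
Implicit Types (v : G) (B : {set G}).

Definition nbh v : {set G} := [set w | v -- w].
Definition cl_nbh v : {set G} := v |: nbh v.
Definition cl_nbhs B : {set G} := \bigcup_(b in B) cl_nbh b.
Definition nbhs B : {set G} := cl_nbhs B :\: B.

Definition leaf v : bool := #|nbh v| == 1.

Definition independent B : bool :=
  [forall u in B, forall v in B, ~~ (u -- v)].

Definition esi B : bool :=
  independent B && [forall v in nbhs B, exists w in ~: cl_nbhs B, v -- w].

End Sets.

Definition alpha (G : sgraph) : nat :=
  \max_(B : {set G} | independent B) #|B|.

Definition alpha_es (G : sgraph) : nat := \max_(B : {set G} | esi B) #|B|.

Section AttachLeaves.
Variables (G : sgraph) (k : G -> nat).

(* For each vertex v of G, the k v pairs [inr (existT _ v i)] are the new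
   leaves attached to v. *)
Definition attach_vertex : finType := (G + {v : G & 'I_(k v)})%type.

Definition attach_edge (u v : attach_vertex) : bool :=
  match u, v with
  | inl u, inl v => u -- v
  | inl u, inr l => tag l == u
  | inr l, inl v => tag l == v
  | inr _, inr _ => false
  end.

Fact attach_edge_sym : symmetric attach_edge.
Proof. by move=> [u|l] [v|m] //=; apply: edge_sym. Qed.

Fact attach_edge_irrefl : irreflexive attach_edge.
Proof. by move=> [u|l] //=; apply: edge_irrefl. Qed.

Definition attach_leaves : sgraph :=
  SGraph attach_edge_sym attach_edge_irrefl.

End AttachLeaves.

(* K_{1,t}, with center [None]. *)
Section Star.
Variable t : nat.

Definition star_edge (u v : option 'I_t) : bool := isSome u (+) isSome v.

Fact star_edge_sym : symmetric star_edge.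
Proof. by move=> u v; apply: addbC. Qed.

Fact star_edge_irrefl : irreflexive star_edge.
Proof. by move=> u; apply: addbb. Qed.

Definition star : sgraph := SGraph star_edge_sym star_edge_irrefl.

End Star.

Definition K2_edge (u v : bool) : bool := u (+) v.

Fact K2_edge_sym : symmetric K2_edge. Proof. exact: addbC. Qed.
Fact K2_edge_irrefl : irreflexive K2_edge. Proof. exact: addbb. Qed.

Definition K2 : sgraph := SGraph K2_edge_sym K2_edge_irrefl.

Definition double_star (a b : nat) : sgraph :=
  attach_leaves (fun v : K2 => if v then a else b).

Definition is_star (G : sgraph) : Prop :=
  exists2 t : nat, 1 <= t & isomorphic G (star t).

(* The families are closed under isomorphism.  For t >= 2, the leaves of
   [star t] in the sense of [leaf] are the vertices other than the center. *)
Definition family_A (G : sgraph) : Prop :=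
  exists (t : nat) (k : star t -> nat),
    [/\ 2 <= t,
        forall v : star t, leaf v -> 1 <= k v,
        forall v : star t, ~~ leaf v -> k v = 0
      & isomorphic G (attach_leaves k)].

Definition family_B (G : sgraph) : Prop :=
  exists (t : nat) (y : star t) (k : star t -> nat),
    [/\ 2 <= t,
        leaf y /\ k y = 0,
        forall v : star t, leaf v -> v != y -> 1 <= k v,
        forall v : star t, ~~ leaf v -> k v = 0
      & isomorphic G (attach_leaves k)].

Definition family_C (G : sgraph) : Prop :=
  exists (a b : nat) (k : double_star a b -> nat),
    [/\ 1 <= a /\ 1 <= b,
        forall v : double_star a b, leaf v -> 1 <= k v,
        forall v : double_star a b, ~~ leaf v -> k v = 0
      & isomorphic G (attach_leaves k)].

(* Main.v *)
(** An ESI-set B of size alpha - 1 is tight exactly when the set W of vertices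
    outside N[B] is a clique and every vertex of B is a leaf.  Two nonadjacent
    vertices of W could both be added to B; two neighbours of some b in B
    would close a cycle through W.  Conversely, sending each vertex of an
    independent set outside W to itself or to a leaf of B next to it is
    injective.  In a tree W is a vertex or an edge, all of N(B) is adjacent to
    W, and removing the leaves in B leaves a star or a double star. *)
Require Import Defs.
From mathcomp Require Import all_boot.

Set Implicit Arguments.
Unset Strict Implicit.
Unset Printing Implicit Defensive.

(** * Closed neighbourhoods, ESI-sets, and the upper bound on the independence number *)

Section Neighbourhoods.
Variable G : sgraph.
Implicit Types (u v w : G) (B S : {set G}).

Lemma in_cl_nbhs B v :
  (v \in cl_nbhs B) = (v \in B) || [exists b in B, b -- v].
Proof.
apply/bigcupP/orP => [[b bB]|[vB|/exists_inP[b bB bv]]].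
- by rewrite !inE => /predU1P[->|bv]; [left | right; apply/exists_inP; exists b].
- by exists v => //; rewrite !inE eqxx.
- by exists b => //; rewrite !inE bv orbT.
Qed.

Lemma cl_nbhsPn B v :
  reflect (v \notin B /\ {in B, forall b, ~~ b -- v}) (v \notin cl_nbhs B).
Proof.
rewrite in_cl_nbhs negb_or negb_exists_in.
by apply: (iffP andP) => -[vB /forall_inP].
Qed.

Lemma in_nbhs B v : (v \in nbhs B) = (v \notin B) && [exists b in B, b -- v].
Proof. by rewrite inE in_cl_nbhs; case: (v \in B). Qed.

Lemma independentP B :
  reflect {in B &, forall u v, ~~ u -- v} (independent B).
Proof.
apply: (iffP forall_inP) => [indB u v uB vB|indB u uB].
  exact: (forall_inP (indB u uB)).
by apply/forall_inP => v; apply: indB.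
Qed.

Lemma esiP B :
  reflect (independent B /\
    {in nbhs B, forall v, exists2 w, w \notin cl_nbhs B & v -- w}) (esi B).
Proof.
apply: (iffP andP) => -[indB far]; split => //.
  by move=> v vB; have /exists_inP[w] := forall_inP far v vB; rewrite inE; exists w.
apply/forall_inP => v vB; apply/exists_inP.
by have [w wB vw] := far v vB; exists w; rewrite ?inE.
Qed.

Lemma esi0 : esi (set0 : {set G}).
Proof.
apply/esiP; split; first by apply/independentP => u v; rewrite inE.
by move=> v; rewrite in_nbhs => /andP[_ /exists_inP[b]]; rewrite inE.
Qed.

Lemma independentU1 B v :
  independent B -> v \notin cl_nbhs B -> independent (v |: B).
Proof.
move=> /independentP indB /cl_nbhsPn[_ far]; apply/independentP => a b.
move=> /setU1P[->|aB] /setU1P[->|bB]; rewrite ?edge_irrefl //; last exact: indB.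
- by rewrite edge_sym far.
- exact: far.
Qed.

Lemma leq_alpha B : independent B -> #|B| <= alpha G.
Proof. by move=> indB; apply: (bigmax_sup B). Qed.

Lemma leq_alpha_es B : esi B -> #|B| <= alpha_es G.
Proof. by move=> esiB; apply: (bigmax_sup B). Qed.

Lemma alpha_es_max : exists2 B : {set G}, esi B & #|B| = alpha_es G.
Proof.
have [|B esiB eB] := eq_bigmax_cond (fun B : {set G} => #|B|) (A := @esi G).
  by apply/card_gt0P; exists set0; apply: esi0.
by exists B.
Qed.

(** This is the tightness condition. That members of [B] are leaves is stated as having at most one
    neighbour, which is the form in which it yields injectivity below; in a connected graph with two
    vertices a neighbour always exists. *)
Definition pendant_support B : Prop :=
  [/\ esi B, {in B, forall b v w, b -- v -> b -- w -> v = w}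
    & {in [predC cl_nbhs B] &, forall v w, v != w -> v -- w}].

Lemma alpha_pendant_support B : pendant_support B -> alpha G <= #|B|.+1.
Proof.
case=> /esiP[/independentP indB _] pendB cliqueB.
apply/bigmax_leqP => S /independentP indS.
rewrite -(cardsID (cl_nbhs B) S) -addn1 leq_add //; last first.
  apply/card_le1P => v /setDP[vS vB] w; rewrite !inE.
  apply/andP/eqP => [[wB wS]|->//]; apply/eqP/negPn/negP => wv.
  by have := indS _ _ wS vS; rewrite cliqueB.
pose f v := if v \in B then v else odflt v [pick b in B | b -- v].
have fP v : v \in cl_nbhs B -> f v \in B /\ (v = f v \/ f v -- v).
  rewrite in_cl_nbhs /f; case: ifP => [vB _|_ /exists_inP[b bB bv]].
    by split; [|left].
  case: pickP => [c /andP[cB cv]|/(_ b)]; first by split; [|right].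
  by rewrite /= bB bv.
have f_inj : {in S :&: cl_nbhs B &, injective f}.
  move=> v w /setIP[vS /fP[fvB fv]] /setIP[wS /fP[fwB fw]] e.
  (* Let b be the common image. If just one of [v], [w] equals b, the other is adjacent to it inside
     [S]; if both are neighbours of b, they coincide because b has at most one neighbour. *)
  rewrite -{}e in fw; case: fv fw => [ev|fv] [ew|fw].
  - by rewrite ev ew.
  - by have := indS _ _ vS wS; rewrite {1}ev fw.
  - by have := indS _ _ wS vS; rewrite {1}ew fv.
  - exact: pendB fv fw.
rewrite -(card_in_imset f_inj); apply/subset_leq_card/subsetP => _ /imsetP[v + ->].
by move=> /setIP[_ /fP[]].
Qed.

End Neighbourhoods.

Arguments cl_nbhsPn {G B v}.
Arguments esiP {G B}.

(** * Consequences of connectedness and acyclicity: the gap between the two parameters, and tight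
    ESI-sets *)

Section Trees.
Variable T : sgraph.
Hypotheses (connT : connected T) (T_gt1 : 1 < #|T|).
Implicit Types (u v w x y : T) (B : {set T}).

Lemma exists_nbh v : exists w, v -- w.
Proof.
have /card_gt1P[a [b [_ _ ab]]] := T_gt1.
have [u uv] : exists u, u != v.
  by have [av|av] := eqVneq a v; [exists b; rewrite -av eq_sym | exists a].
have /connectP[[|w p] /=] := connT.2 v u; first by move=> _ e; rewrite e eqxx in uv.
by move=> /andP[vw _] _; exists w.
Qed.

(** Any vertex of N[B] gives a vertex of N(B): itself, or a neighbour of it if it lies in [B]. The
    ESI condition then supplies a vertex outside N[B]. *)
Lemma esi_exists_far B : esi B -> exists w, w \notin cl_nbhs B.
Proof.
move=> /esiP[/independentP indB far].
have /card_gt0P[v _] := connT.1.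
have [vN|] := boolP (v \in cl_nbhs B); last by exists v.
have [w vw] := exists_nbh v.
have [z zB] : exists z, z \in nbhs B.
  have [vB|vB] := boolP (v \in B); last by exists v; rewrite inE vB.
  exists w; rewrite in_nbhs; apply/andP; split; last by apply/exists_inP; exists v.
  by apply: contraL vw => wB; apply: indB.
by have [u uB _] := far z zB; exists u.
Qed.

Lemma alpha_es_lt : alpha_es T < alpha T.
Proof.
have [B esiB <-] := alpha_es_max T.
have [w wB] := esi_exists_far esiB.
have <- : #|w |: B| = #|B|.+1 by rewrite cardsU1; case/cl_nbhsPn: wB => ->.
by apply/leq_alpha/independentU1 => //; case/esiP: esiB.
Qed.

Lemma pendant_support_alpha B : pendant_support B -> alpha_es T = alpha T - 1.
Proof.
move=> suppB; have le1 : #|B| <= alpha_es T by case: suppB => /leq_alpha_es.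
(* The successor form avoids truncated subtraction; it follows from the strict inequality and
   [alpha T <= #|B|.+1 <= (alpha_es T).+1]. *)
have /eqP -> : alpha T == (alpha_es T).+1; last by rewrite subn1.
by rewrite eqn_leq alpha_es_lt andbT (leq_trans (alpha_pendant_support suppB)).
Qed.

Hypothesis acT : acyclic T.

Lemma acyclicPn c : 2 < size c -> uniq c -> ~~ cycle (@edge T) c.
Proof.
by move=> c_gt2 uc; apply: contraL c_gt2 => cc; rewrite -leqNgt acT /ucycle ?cc.
Qed.

Lemma edge_neq u v : u -- v -> u != v.
Proof. by apply: contraTneq => ->; rewrite edge_irrefl. Qed.

Lemma triangle_free u v w : u -- v -> v -- w -> ~~ u -- w.
Proof.
move=> uv vw; apply/negP => uw.
have := @acyclicPn [:: u; v; w]; rewrite /= !inE uv vw (edge_sym w) uw.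
by rewrite negb_or !edge_neq // => /(_ isT isT).
Qed.

(** Otherwise the four vertices are pairwise distinct, since the adjacent ones differ anyway, and
    form a 4-cycle. *)
Lemma square_free u v w z :
  u -- v -> v -- w -> w -- z -> z -- u -> v != z -> u = w.
Proof.
move=> uv vw wz zu vz; apply/eqP/negPn/negP => uw.
have uz : u -- z by rewrite edge_sym.
have := @acyclicPn [:: u; v; w; z]; rewrite /= !inE uv vw wz zu.
by rewrite !negb_or uw vz !edge_neq // => /(_ isT isT).
Qed.

Lemma esi_alpha_pendant_support B :
  esi B -> #|B| = alpha T - 1 -> pendant_support B.
Proof.
move=> esiB cardB; have [/independentP indB farB] := esiP esiB.
have cliqueB : {in [predC cl_nbhs B] &, forall v w, v != w -> v -- w}.
  move=> v w; rewrite !inE => vB wB vw; apply/negPn/negP => nvw.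
  (* The enlarged set would have [alpha T + 1] elements. This count needs [alpha T] positive, which
     [alpha_es_lt] provides. *)
  suff : #|v |: (w |: B)| <= alpha T.
    have [vnB _] := cl_nbhsPn vB; have [wnB _] := cl_nbhsPn wB.
    rewrite !cardsU1 !inE negb_or vw vnB wnB cardB !add1n subn1 prednK ?ltnn //.
    exact: leq_ltn_trans alpha_es_lt.
  apply/leq_alpha/independentU1; first exact/independentU1/wB/independentP.
  apply/cl_nbhsPn; have [vnB nv] := cl_nbhsPn vB.
  rewrite !inE negb_or vw vnB; split=> // b /setU1P[->|/nv//].
  by rewrite edge_sym.
(* Two neighbours [v], [w] of [b] have neighbours [v'], [w'] outside N[B]. If [v' = w'], then b, v,
   v', w is a 4-cycle; otherwise [v'] and [w'] are adjacent and b, v, v', w', w is a 5-cycle. *)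
split=> // b bB v w bv bw; apply/eqP/negPn/negP => vw.
have far u : b -- u -> exists2 z, z \notin cl_nbhs B & u -- z.
  move=> bu; apply: farB; rewrite in_nbhs; apply/andP; split.
    by apply: contraL bu => uB; apply: indB.
  by apply/exists_inP; exists b.
have [v' v'B vv'] := far v bv; have [w' w'B ww'] := far w bw.
have [v'b nv'] := cl_nbhsPn v'B; have [w'b nw'] := cl_nbhsPn w'B.
have bv' : b != v' by apply: contraNneq v'b => <-.
have bw' : b != w' by apply: contraNneq w'b => <-.
have [e|v'w'] := eqVneq v' w'.
  case/eqP: bv'; apply: (square_free bv vv' _ _ vw); last by rewrite edge_sym.
  by rewrite e edge_sym.
have e : v' -- w' by apply: cliqueB.
have vw' : v != w' by apply: contraTneq bv => ->; apply: nw'.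
have v'w : v' != w by apply: contraTneq bw => <-; apply: nv'.
have := @acyclicPn [:: b; v; v'; w'; w].
have w'w : w' -- w by rewrite edge_sym.
rewrite /= !inE bv vv' e w'w (edge_sym w) bw !negb_or.
by rewrite bv' bw' vw vw' v'w !edge_neq // => /(_ isT isT).
Qed.

End Trees.

(** * Constructing pendant supports: transport along isomorphisms and attached leaves *)

Lemma pendant_support_iso (G H : sgraph) (B : {set H}) :
  isomorphic G H -> pendant_support B ->
  exists B' : {set G}, pendant_support B'.
Proof.
move=> [f [g fK gK] f_edge] [/esiP[/independentP indB farB] pendB cliqueB].
pose B' := f @^-1: B; exists B'.
have clE v : (v \in cl_nbhs B') = (f v \in cl_nbhs B).
  rewrite !in_cl_nbhs inE; congr (_ || _).
  apply/exists_inP/exists_inP => -[b bB bv]; [exists (f b)|exists (g b)].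
  - by rewrite inE in bB.
  - by rewrite f_edge.
  - by rewrite inE gK.
  - by rewrite -f_edge gK.
split.
- apply/esiP; split.
    by apply/independentP => u v; rewrite !inE -f_edge; apply: indB.
  move=> v; rewrite inE clE inE => vB; have [|w wB vw] := farB (f v).
    by rewrite inE.
  by exists (g w); rewrite ?clE -?f_edge gK.
- move=> b; rewrite inE => bB v w bv bw; apply: (can_inj fK).
  by apply: (pendB _ bB); rewrite f_edge.
- move=> v w; rewrite !inE !clE => vB wB vw; rewrite -f_edge cliqueB ?inE //.
  by rewrite (can_eq fK).
Qed.

(** Take [B] to be all the new leaves. The vertices outside N[B] are then exactly the old ones with
    [k v = 0], so the first hypothesis is the ESI condition and the second the clique condition. *)
Lemma attach_pendant_support (G : sgraph) (k : G -> nat) :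
    (forall v, 0 < k v -> exists2 w, k w = 0 & v -- w) ->
    (forall v w, k v = 0 -> k w = 0 -> v != w -> v -- w) ->
  exists B : {set attach_leaves k}, pendant_support B.
Proof.
move=> dom0 clique0.
pose new (v : attach_vertex k) := if v is inr _ then true else false.
pose B : {set attach_leaves k} := [set v | new v]; exists B.
have clE (v : attach_leaves k) : (v \in cl_nbhs B) =
    if (v : attach_vertex k) is inl u then 0 < k u else true.
  rewrite in_cl_nbhs inE; case: v => [u|//] /=.
  apply/exists_inP/idP => [[[w|[w i]]]|ku]; rewrite ?inE //=.
    by move=> _ /eqP<-; case: i => i; apply: leq_ltn_trans.
  by exists (inr (existT _ u (Ordinal ku))); rewrite ?inE /= ?eqxx.
split.
- apply/esiP; split; first by apply/independentP => -[u|l] [v|m]; rewrite !inE.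
  move=> v; rewrite inE clE inE; case: v => [u /= /dom0[w kw uw]|//].
  by exists (inl w); rewrite ?clE ?kw.
- by move=> [b|l]; rewrite !inE // => _ [v|?] [w|?] //= /eqP-> /eqP->.
- move=> [v|l] [w|m]; rewrite !inE !clE // -!leqNgt !leqn0 => /eqP kv /eqP kw vw.
  by apply: clique0 => //; apply: contraNneq vw => ->.
Qed.

(** * Pendant supports in stars and in the three families *)

Section Leaves.
Variable G : sgraph.
Implicit Types u v w : G.

Lemma leafE v w : nbh v = [set w] -> leaf v.
Proof. by move=> e; rewrite /leaf e cards1. Qed.

Lemma leafPn v a b : v -- a -> v -- b -> a != b -> ~~ leaf v.
Proof.
move=> va vb ab; apply/negP => /cards1P[w e].
have : a \in nbh v by rewrite inE.
have : b \in nbh v by rewrite inE.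
by rewrite e !inE => /eqP eb /eqP ea; rewrite ea eb eqxx in ab.
Qed.

End Leaves.

Lemma leaf_star t (v : star t) : 1 < t -> leaf v = isSome v.
Proof.
case: v => [i|] /= t_gt1.
  by apply: (@leafE (star t) _ None); apply/setP => -[j|]; rewrite !inE.
(* The leaves with indices 1 and 0 are two distinct neighbours of the center. *)
apply/negbTE; apply: (@leafPn (star t) _ (Some (Ordinal t_gt1))
  (Some (Ordinal (ltnW t_gt1)))) => //.
Qed.

Lemma leaf_double_star a b (v : double_star a b) : 0 < a -> 0 < b ->
  leaf v = if (v : attach_vertex _) is inr _ then true else false.
Proof.
move=> a_gt0 b_gt0; case: v => [e|l] /=.
  pose k (v : K2) := if v then a else b; apply/negbTE.
  have ke : 0 < k e by rewrite /k; case: (e).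
  apply: (@leafPn (double_star a b) _ (inl (~~ e)) (inr (existT _ e (Ordinal ke)))) => //=.
  by case: (e).
apply: (@leafE (double_star a b) _ (inl (tag l))); apply/setP => -[e|m]; rewrite !inE //=.
by rewrite eq_sym.
Qed.

(** All leaves but one are taken: the omitted leaf [i0] is the outside neighbour that the ESI
    condition demands of the center, and the outside clique is the edge between them. For [t = 1]
    the set is empty. *)
Lemma star_pendant_support t :
  0 < t -> exists B : {set star t}, pendant_support B.
Proof.
move=> t_gt0; pose i0 := Ordinal t_gt0.
pose B : {set star t} := [set v | isSome v && (v != Some i0)]; exists B.
have farP (v : star t) : v \notin cl_nbhs B -> v = None \/ v = Some i0.
  case: v => [i|]; last by left.
  by rewrite in_cl_nbhs inE /= negb_or negbK => /andP[/eqP-> _]; right.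
split.
- apply/esiP; split; first by apply/independentP => -[u|] [v|]; rewrite !inE.
  move=> [i|]; rewrite in_nbhs => /andP[iB /exists_inP[[j|] jB jv]] //.
    by rewrite inE in jB.
  exists (Some i0) => //; apply/cl_nbhsPn; split; first by rewrite inE eqxx.
  by move=> [b|] //; rewrite inE.
- by move=> [b|]; rewrite inE // => _ [v|] [w|].
- by move=> v w /farP[->|->] /farP[->|->]; rewrite ?eqxx.
Qed.

(** Here only the center receives no new leaf, so the outside clique is a single vertex. *)
Lemma family_A_pendant_support G :
  family_A G -> exists B : {set G}, pendant_support B.
Proof.
move=> [t [k [t_gt1 k_leaf k_inner isoG]]].
have k0 v : k v = 0 -> v = None.
  by case: v => // i ki; have := k_leaf (Some i); rewrite leaf_star // ki => /(_ isT).
have kN : k None = 0 by rewrite k_inner ?leaf_star.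
have [||B] := attach_pendant_support (k := k); last exact: pendant_support_iso.
  by move=> [i _|]; [exists None | rewrite kN].
by move=> v w /k0-> /k0->; rewrite eqxx.
Qed.

(** Here the outside clique is the edge from the center to the exceptional leaf [y]. *)
Lemma family_B_pendant_support G :
  family_B G -> exists B : {set G}, pendant_support B.
Proof.
move=> [t [y [k [t_gt1 [y_leaf ky] k_leaf k_inner isoG]]]].
rewrite leaf_star // in y_leaf; case: y => // y in y_leaf ky k_leaf *.
have k0 v : k v = 0 -> v = None \/ v = Some y.
  case: v => [i ki|]; last by left.
  have [->|iy] := eqVneq (Some i) (Some y); first by right.
  by have := k_leaf (Some i); rewrite leaf_star // ki => /(_ isT iy).
have kN : k None = 0 by rewrite k_inner ?leaf_star.
have [||B] := attach_pendant_support (k := k); last exact: pendant_support_iso.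
  by move=> [i _|]; [exists None | rewrite kN].
by move=> v w /k0[->|->] /k0[->|->]; rewrite ?eqxx.
Qed.

(** Here the outside clique is the central edge of the double star. *)
Lemma family_C_pendant_support G :
  family_C G -> exists B : {set G}, pendant_support B.
Proof.
move=> [a [b [k [[a_gt0 b_gt0] k_leaf k_inner isoG]]]].
have k0 v : k v = 0 -> exists e, v = inl e.
  case: v => [e|l kl]; first by exists e.
  by have := k_leaf (inr l); rewrite leaf_double_star // kl => /(_ isT).
have ki e : k (inl e) = 0 by rewrite k_inner ?leaf_double_star.
have [||B] := attach_pendant_support (k := k); last exact: pendant_support_iso.
  move=> [e|l _]; first by rewrite ki.
  by exists (inl (tag l)) => //=.
by move=> v w /k0[[] ->] /k0[[] ->]; rewrite ?eqxx.
Qed.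

(** * Induced embeddings, and extending them by attached leaves *)

Definition embedding (G H : sgraph) (f : G -> H) : Prop :=
  injective f /\ forall u v : G, f u -- f v = u -- v.

Lemma embedding_isomorphic (G H : sgraph) (f : G -> H) :
  embedding f -> (forall y, y \in codom f) -> isomorphic H G.
Proof.
move=> [f_inj f_edge] surj; pose g y := iinv (surj y).
have gK : cancel g f by move=> y; apply: f_iinv.
exists g; last by move=> u v; rewrite -f_edge !gK.
by exists f => // x; apply: f_inj; rewrite gK.
Qed.

(** The i-th new leaf at [h] goes to the i-th neighbour of [g h] in [L]. Uniqueness of the parent
    makes this injective and reflects edges. Keeping [k] a variable allows the function built into
    [double_star], which equals these cardinalities only propositionally. *)
Lemma attach_embedding (H T : sgraph) (g : H -> T) (L : {set T}) (k : H -> nat) :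
    embedding g -> (forall h, k h = #|nbh (g h) :&: L|) ->
    independent L -> (forall h, g h \notin L) ->
    {in L, forall b h h', g h -- b -> g h' -- b -> h = h'} ->
  exists f : attach_leaves k -> T,
    [/\ embedding f, forall h, f (inl h) = g h, forall l, f (inr l) \in L
      & {in L, forall b h, g h -- b -> b \in codom f}].
Proof.
move=> [g_inj g_edge] kE /independentP indL gL uniqL.
pose new (h : H) (i : 'I_(k h)) : T := enum_val (cast_ord (kE h) i).
pose f (v : attach_vertex k) : T :=
  match v with inl h => g h | inr l => new (tag l) (tagged l) end.
have newP h i : g h -- new h i /\ new h i \in L.
  by have := enum_valP (cast_ord (kE h) i); rewrite inE in_set => /andP[].
exists f; split=> [|//|l|b bL h hb]; last 2 first.
- by case: (newP _ (tagged l)).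
- have bA : b \in nbh (g h) :&: L by rewrite inE in_set hb.
  apply/codomP; exists (inr (existT _ h (cast_ord (esym (kE h)) (enum_rank_in bA b)))).
  by rewrite /f /new /= cast_ordKV enum_rankK_in.
split.
- move=> [h|[h i]] [h'|[h' i']] /=; first by move=> /g_inj->.
  + by move=> e; have := gL h; rewrite e (newP h' i').2.
  + by move=> e; have := gL h'; rewrite -e (newP h i).2.
  (* The parents must be identified first: the indices [i] and [i'] have the same type only
     afterwards. *)
  + move=> e; have [hi iL] := newP h i; have [hi' _] := newP h' i'.
    rewrite -e in hi'; have eh := uniqL _ iL _ _ hi hi'; case: _ / eh in i' e *.
    by have /cast_ord_inj-> := enum_val_inj e.
- have mixed h (l : {h : H & 'I_(k h)}) : g h -- new (tag l) (tagged l) = (tag l == h).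
    have [lb bL] := newP _ (tagged l).
    by apply/idP/eqP => [hb|<-//]; apply: uniqL lb hb.
  move=> [h|l] [h'|l'] //=; first by rewrite edge_sym.
  by apply/negbTE/indL; apply: (newP _ _).2.
Qed.

Lemma star_embedding (T : sgraph) (x : T) : independent (nbh x) ->
  exists g : star #|nbh x| -> T,
    [/\ embedding g, g None = x & forall v, x -- v -> exists i, v = g (Some i)].
Proof.
move=> /independentP indx.
pose g (v : option 'I_#|nbh x|) : T := oapp (@enum_val _ _) x v.
have gP i : x -- g (Some i) by have := enum_valP i; rewrite in_set.
exists g; split=> // [|v xv]; last first.
  have vx : v \in nbh x by rewrite in_set.
  by exists (enum_rank_in vx v); rewrite /= enum_rankK_in.
split.
- move=> [i|] [j|] //= e; first by rewrite (enum_val_inj e).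
  + by have := gP i; rewrite /= e edge_irrefl.
  + by have := gP j; rewrite /= -e edge_irrefl.
- move=> [i|] [j|]; rewrite /= /star_edge /=.
  + by apply/negbTE/indx; rewrite enum_valP.
  + by rewrite edge_sym; apply: gP.
  + exact: gP.
  + exact: edge_irrefl.
Qed.

Lemma is_star_center (T : sgraph) (c : T) :
    1 < #|T| -> independent (nbh c) -> (forall v, v != c -> c -- v) -> is_star T.
Proof.
move=> T_gt1 indc domc; have [g [g_emb gN gS]] := star_embedding indc.
exists #|nbh c|.
  have /card_gt1P[a [b [_ _ ab]]] := T_gt1; apply/card_gt0P.
  have [ac|ac] := eqVneq a c; last by exists a; rewrite inE domc.
  by exists b; rewrite inE domc // eq_sym -ac.
apply: (embedding_isomorphic g_emb) => v; apply/codomP.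
have [->|/domc/gS[i ->]] := eqVneq v c; first by exists None.
by exists (Some i).
Qed.

(** * Recovering the shape of a tree from a pendant support *)

Section Decomposition.
Variable T : sgraph.
Hypotheses (connT : connected T) (T_gt1 : 1 < #|T|) (acT : acyclic T).
Variable B : {set T}.
Hypothesis suppB : pendant_support B.
Implicit Types u v w x y : T.

Lemma independent_nbh v : independent (nbh v).
Proof.
apply/independentP => u w; rewrite !inE => vu vw.
by apply: (triangle_free acT (v := v)) => //; rewrite edge_sym.
Qed.

(** With [H] a copy of T - B, the tree is rebuilt by hanging each vertex of [B] on its only
    neighbour, which lies outside [B] by independence. The second conclusion turns membership in
    N[B] into the conditions on [k] in the families. *)
Lemma pendant_attach (H : sgraph) (g : H -> T) :
    embedding g -> (forall v, (v \in codom g) = (v \notin B)) ->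
  exists2 k : H -> nat, isomorphic T (attach_leaves k)
    & forall h, (0 < k h) = (g h \in cl_nbhs B).
Proof.
move=> g_emb codomg; have [/esiP[indB _] pendB _] := suppB.
have gB h : g h \notin B by rewrite -codomg codom_f.
pose k h := #|nbh (g h) :&: B|; exists k; last first.
  move=> h; rewrite in_cl_nbhs (negbTE (gB h)); apply/card_gt0P/exists_inP.
    by move=> [b]; rewrite !inE => /andP[hb bB]; exists b; rewrite // edge_sym.
  by move=> [b bB bh]; exists b; rewrite !inE edge_sym bh.
have [|f [f_emb fl _ fL]] := attach_embedding g_emb (fun h => erefl (k h)) indB gB.
  move=> b bB h h' hb h'b; apply: g_emb.1; apply: (pendB _ bB); rewrite edge_sym //.
apply: (embedding_isomorphic f_emb) => v.
have [vB|] := boolP (v \in B); last first.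
  by rewrite -codomg => /codomP[h ->]; rewrite -fl codom_f.
have [w vw] := exists_nbh connT T_gt1 v.
have : w \notin B.
  by move/independentP: indB => indB; apply: contraL vw; apply: indB.
by rewrite -codomg => /codomP[h wh]; apply: (fL _ vB h); rewrite -wh edge_sym.
Qed.

(** T - B is a star centered at [x]. If [x] has a single neighbour, all of T is a star around that
    neighbour; otherwise the choice between the families depends on whether some neighbour of [x] is
    outside N[B]. *)
Lemma single_center x : x \notin cl_nbhs B ->
    (forall v, v \notin B -> v = x \/ x -- v) ->
  is_star T \/ family_A T \/ family_B T.
Proof.
move=> xB domx; have [xnB farx] := cl_nbhsPn xB; have [_ _ cliqueB] := suppB.
have [nbx_gt1|] := ltnP 1 #|nbh x|; last first.
  have [v xv] := exists_nbh connT T_gt1 x; move=> /card_le1P/(_ v).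
  rewrite inE => /(_ xv) nbx; left.
  have {}nbx w : x -- w -> w = v by have := nbx w; rewrite !inE => -> /eqP.
  apply: (is_star_center (c := v)) (independent_nbh v) _ => // w wv.
  have [->|wx] := eqVneq w x; first by rewrite edge_sym.
  have [wB|/domx[e|/nbx e]] := boolP (w \in B); try by rewrite e eqxx in wx wv.
  have [z wz] := exists_nbh connT T_gt1 w.
  have [/esiP[/independentP indB _] _ _] := suppB.
  have : z \notin B by apply: contraL wz; apply: indB.
  by move=> /domx[ez|/nbx <-]; [rewrite ez (negbTE (farx _ wB)) in wz|rewrite edge_sym].
have [g [g_emb gN gS]] := star_embedding (independent_nbh x).
have xg i : x -- g (Some i) by have := g_emb.2 None (Some i); rewrite gN.
have [|k isoT kE] := pendant_attach g_emb.
  move=> v; apply/codomP/idP => [[[i|] ->]|/domx[->|/gS[i ->]]].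
  - by apply/negP => gB; have := farx _ gB; rewrite edge_sym xg.
  - by rewrite gN.
  - by exists None.
  - by exists (Some i).
have kN : k None = 0.
  by apply/eqP; rewrite -leqn0 leqNgt kE gN.
right; have [/existsP[i yB]|/existsPn allB] := boolP [exists i, g (Some i) \notin cl_nbhs B].
  right; exists #|nbh x|, (Some i), k; split=> //.
  - by rewrite leaf_star //; split=> //; apply/eqP; rewrite -leqn0 leqNgt kE.
  - move=> [j _ ji|]; last by rewrite leaf_star.
    (* A second neighbour of [x] outside N[B] would be adjacent to the first by the clique
       condition, but leaves of a star are not adjacent. *)
    rewrite kE; apply/negPn/negP => zB.
    have := cliqueB (g (Some i)) (g (Some j)); rewrite !inE => /(_ yB zB).
    by rewrite (inj_eq g_emb.1) eq_sym => /(_ ji); rewrite g_emb.2.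
  - by move=> [j|_] //; rewrite leaf_star.
left; exists #|nbh x|, k; split=> //.
- by move=> [j _|]; [have := allB j; rewrite negbK kE | rewrite leaf_star].
- by move=> [j|_] //; rewrite leaf_star.
Qed.

(** T - B is a double star with central edge xy and leaf set N(B). Leaves are attached twice: N(B)
    to the edge, then [B] to the double star. The last two hypotheses make [a] and [b] positive. *)
Lemma double_center x y : x \notin cl_nbhs B -> y \notin cl_nbhs B -> x -- y ->
    {in nbhs B, forall v, x -- v \/ y -- v} ->
    (forall v, v \notin cl_nbhs B -> v = x \/ v = y) ->
    (exists2 u, u \in nbhs B & x -- u) -> (exists2 u, u \in nbhs B & y -- u) ->
  family_C T.
Proof.
move=> xB yB xy domxy farB [u uL xu] [w wL yw].
have [xnB _] := cl_nbhsPn xB; have [ynB _] := cl_nbhsPn yB.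
pose g (e : K2) := if e then x else y.
have yx : y -- x by rewrite edge_sym.
have g_emb : embedding g.
  split; last by move=> [] [] /=; rewrite /g ?edge_irrefl.
  by move=> [] [] //= e; have := edge_neq xy; rewrite e eqxx.
have opp e v : g e -- v -> ~~ g (~~ e) -- v.
  by case: e => /=; apply: (triangle_free acT).
have gfar e : g e \notin cl_nbhs B by rewrite /g; case: ifP.
have Lcl v : v \in nbhs B -> v \in cl_nbhs B by rewrite inE => /andP[].
have Lneq e v : v \in nbhs B -> v != g e.
  by move=> /Lcl; apply: contraTneq => ->; apply: gfar.
have uniqL : {in nbhs B, forall v e e', g e -- v -> g e' -- v -> e = e'}.
  move=> v _ e e' ev e'v; apply/eqP/negPn/negP => ee; have := opp e v ev.
  by have -> : ~~ e = e'; [case: (e) (e') ee => [] [] | rewrite e'v].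
(* An edge inside N(B) would close a triangle if its ends share a center, and a 4-cycle through the
   edge xy if they do not. *)
have indL : independent (nbhs B).
  apply/independentP => v z vL zL; apply/negP => vz.
  have adj t : t \in nbhs B -> exists e, g e -- t.
    by move=> /domxy[]; [exists true | exists false].
  have [e ev] := adj v vL; have [e' e'z] := adj z zL.
  have [ee|ee] := eqVneq e e'.
    by have := triangle_free acT ev vz; rewrite ee e'z.
  have ze' : z -- g e' by rewrite edge_sym.
  have e'e : g e' -- g e by rewrite g_emb.2; case: (e) (e') ee => [] [].
  have := Lneq e z zL.
  by rewrite -(square_free acT ev vz ze' e'e (Lneq _ _ vL)) eqxx.
pose a := #|nbh x :&: nbhs B|; pose b := #|nbh y :&: nbhs B|.
have a_gt0 : 0 < a by apply/card_gt0P; exists u; rewrite inE in_set xu.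
have b_gt0 : 0 < b by apply/card_gt0P; exists w; rewrite inE in_set yw.
have kE (e : K2) : (if e then a else b) = #|nbh (g e) :&: nbhs B| by case: e.
have [|f [f_emb fl fr fL]] := attach_embedding g_emb kE indL _ uniqL.
  by move=> e; apply/negP => /(Lneq e); rewrite eqxx.
have [|k isoT k_gt0] := @pendant_attach (double_star a b) f f_emb.
  move=> v; apply/codomP/idP => [[[e|l] ->]|vB].
  - by rewrite fl; case/cl_nbhsPn: (gfar e).
  - by have := fr l; rewrite inE => /andP[].
  - apply/codomP; have [vcl|/farB[]->] := boolP (v \in cl_nbhs B).
    + have vL : v \in nbhs B by rewrite inE vB.
      by have [xv|yv] := domxy v vL; [apply: (fL v vL true)|apply: (fL v vL false)].
    + by rewrite -[x](fl true) codom_f.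
    + by rewrite -[y](fl false) codom_f.
exists a, b, k; split=> // -[e|l]; rewrite leaf_double_star //.
- by rewrite k_gt0 Lcl.
- by move=> _; apply/eqP; rewrite -leqn0 leqNgt k_gt0 fl.
Qed.

(** The set outside N[B] is a nonempty clique in a triangle-free graph, hence a vertex or an
    edge. *)
Lemma pendant_support_families :
  is_star T \/ family_A T \/ family_B T \/ family_C T.
Proof.
have [/[dup] esiB /esiP[_ farL] _ cliqueB] := suppB.
have [x xB] := esi_exists_far connT T_gt1 esiB.
have single z : z \notin cl_nbhs B -> (forall v, v \notin B -> v = z \/ z -- v) ->
    is_star T \/ family_A T \/ family_B T \/ family_C T.
  move=> zB domz; have := single_center zB domz; tauto.
have [/existsP[y /andP[yB yx]]|/existsPn only_x] :=
    boolP [exists y, (y \notin cl_nbhs B) && (y != x)]; last first.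
  have {}only_x v : v \notin cl_nbhs B -> v = x.
    by move=> vB; apply/eqP; have := only_x v; rewrite vB negbK.
  apply: (single x) => // v vB.
  have [vcl|/only_x] := boolP (v \in cl_nbhs B); last by left.
  have [|w /only_x-> vx] := farL v; first by rewrite inE vB.
  by right; rewrite edge_sym.
have xy : x -- y by apply: cliqueB; rewrite ?inE // eq_sym.
have farB v : v \notin cl_nbhs B -> v = x \/ v = y.
  move=> vB; have [->|vx] := eqVneq v x; first by left.
  have [->|vy] := eqVneq v y; first by right.
  have vx' : v -- x by apply: cliqueB; rewrite ?inE.
  by have := triangle_free acT vx' xy; rewrite cliqueB ?inE.
have domxy : {in nbhs B, forall v, x -- v \/ y -- v}.
  by move=> v /farL[w /farB[]-> vw]; [left|right]; rewrite edge_sym.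
(* If one end of the edge xy has no neighbour in N(B), the other end is adjacent to everything else
   outside [B], and the single-center case applies. *)
have [/exists_inP nx|/exists_inPn nx] := boolP [exists u in nbhs B, x -- u]; last first.
  apply: (single y) => // v vB; have [vcl|/farB[]->] := boolP (v \in cl_nbhs B).
  - have vL : v \in nbhs B by rewrite inE vB.
    by have [xv|] := domxy v vL; [have := nx v vL; rewrite xv | right].
  - by right; rewrite edge_sym.
  - by left.
have [/exists_inP ny|/exists_inPn ny] := boolP [exists u in nbhs B, y -- u]; last first.
  apply: (single x) => // v vB; have [vcl|/farB[]->] := boolP (v \in cl_nbhs B).
  - have vL : v \in nbhs B by rewrite inE vB.
    by have [|yv] := domxy v vL; [right | have := ny v vL; rewrite yv].
  - by left.
  - by right.
by do 3!right; apply: double_center xB yB xy domxy farB nx ny.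
Qed.

End Decomposition.

Theorem theorem20 (T : sgraph) (hT : is_tree T) (hT2 : 2 <= #|T|) :
  alpha_es T = alpha T - 1 <->
  is_star T \/ family_A T \/ family_B T \/ family_C T.
Proof.
case: hT => connT acT; split=> [eqa|fam].
  have [B esiB cardB] := alpha_es_max T; rewrite eqa in cardB.
  exact: pendant_support_families (esi_alpha_pendant_support _ _ _ esiB cardB).
suff [B /pendant_support_alpha->] : exists B : {set T}, pendant_support B by [].
case: fam => [[t t_gt0 isoT]|[famA|[famB|famC]]].
- have [B] := star_pendant_support t_gt0; exact: pendant_support_iso isoT.
- exact: family_A_pendant_support famA.
- exact: family_B_pendant_support famB.
- exact: family_C_pendant_support famC.
Qed.
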